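(* Let $A = (a_{ij})_{i,j=1}^n$ be a real $n \times n$ matrix such that $-A$ is diagonally stable, and let $\mathcal{D}(A)$ be the set of Lyapunov scaling factors of $-A$. Then $$\det A \leq \left(\Big(\inf_{D \in \mathcal{D}(A)} \|\mathrm{Skew}(DA)\|\,\|(\mathrm{Sym}(DA))^{-1}\|\Big)^2 + 1\right)^{\frac{n}{2}} \prod_{i=1}^n a_{ii}.$$
   Context: A positive diagonal matrix is a diagonal matrix with all diagonal entries $>0$. A real $n\times n$ matrix $M$ is called diagonally stable if there is a positive diagonal matrix $D$ such that $DM + M^T D$ is negative definite; any such $D$ is called a Lyapunov scaling factor of $M$. (So $\mathcal{D}(A)$ here consists of all positive diagonal $D$ with $DA + A^TD$ positive definite.) Notation: $\mathrm{Sym}(M) = \frac{M+M^T}{2}$, $\mathrm{Skew}(M) = \frac{M - M^T}{2}$, and $\|M\| = \sup_{\|x\|=1}\|Mx\|$ is the operator norm induced by the Euclidean norm. *)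

(* Defs.v *)
From mathcomp Require Import all_boot all_order all_algebra.
From mathcomp Require Import all_classical all_reals all_analysis.

Set Implicit Arguments.
Unset Strict Implicit.
Unset Printing Implicit Defensive.

Import Order.TTheory GRing.Theory Num.Theory.
Local Open Scope classical_set_scope.
Local Open Scope ring_scope.

Definition pos_diag_mx (R : realType) (n : nat) (D : 'M[R]_n) : Prop :=
  is_diag_mx D /\ forall i, 0 < D i i.

(* Used below only for symmetric matrices. *)
Definition negdef_mx (R : realType) (n : nat) (M : 'M[R]_n) : Prop :=
  forall x : 'cV[R]_n, x != 0 -> (x^T *m M *m x) 0 0 < 0.

Definition lyapunov_factors (R : realType) (n : nat) (M : 'M[R]_n) :
    set 'M[R]_n :=
  [set D | pos_diag_mx D /\ negdef_mx (D *m M + M^T *m D)].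

Definition diag_stable (R : realType) (n : nat) (M : 'M[R]_n) : Prop :=
  exists D, lyapunov_factors M D.

Definition Sym (R : realType) (n : nat) (M : 'M[R]_n) : 'M[R]_n :=
  2^-1 *: (M + M^T).

Definition Skew (R : realType) (n : nat) (M : 'M[R]_n) : 'M[R]_n :=
  2^-1 *: (M - M^T).

(* Euclidean norms, unlike the canonical `|_|, which is the max norm on matrices.
   For n = 0 the unit sphere is empty and op_norm is sup set0 = 0. *)
Definition euclid_norm (R : realType) (n : nat) (x : 'cV[R]_n) : R :=
  Num.sqrt (\sum_i x i 0 ^+ 2).

Definition op_norm (R : realType) (n : nat) (M : 'M[R]_n) : R :=
  sup [set euclid_norm (M *m x) | x in [set x : 'cV[R]_n | euclid_norm x = 1]].

(* Main.v *)
(** Write [D A = P + S] with [P] symmetric positive definite and [S] skew, and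
    let [P = L L^T] be a Cholesky factorization.  Then [D A = L (1 + K) L^T]
    with [K = L^-1 S L^-T] skew, so [det (D A) = det P * det (1 + K)].
    Hadamard's inequality bounds [det P] by the product of the [D i i * A i i].
    Applied to [(1 + K) (1 + K)^T = 1 + K K^T] it also bounds [det (1 + K) ^ 2]
    by [(1 + |K|^2) ^ n], and [|K| <= |S| |P^-1|] because [L^-T L^-1 = P^-1]. *)
Require Import Defs.
From mathcomp Require Import all_boot all_order all_algebra.
From mathcomp Require Import all_classical all_reals all_analysis.
From mathcomp Require Import ring lra.

Set Implicit Arguments.
Unset Strict Implicit.
Unset Printing Implicit Defensive.

Import Order.TTheory GRing.Theory Num.Theory.
Local Open Scope classical_set_scope.
Local Open Scope ring_scope.

(** * Euclidean and operator norms *)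

Section EuclideanNorm.
Context {R : realType}.

Lemma euclid_norm_ge0 n (x : 'cV[R]_n) : 0 <= euclid_norm x.
Proof. exact: sqrtr_ge0. Qed.

Lemma dotmxE n (x y : 'cV[R]_n) : (x^T *m y) 0 0 = \sum_i x i 0 * y i 0.
Proof. by rewrite mxE; apply: eq_bigr => i _; rewrite mxE. Qed.

Lemma sqr_euclid_norm n (x : 'cV[R]_n) : euclid_norm x ^+ 2 = (x^T *m x) 0 0.
Proof.
rewrite sqr_sqrtr; last by apply: sumr_ge0 => i _; rewrite sqr_ge0.
by rewrite dotmxE; apply: eq_bigr => i _; rewrite expr2.
Qed.

Lemma euclid_norm_eq0 n (x : 'cV[R]_n) : (euclid_norm x == 0) = (x == 0).
Proof.
apply/eqP/eqP => [x0|->]; last first.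
  by rewrite /euclid_norm big1 ?sqrtr0// => i _; rewrite mxE expr0n.
have: \sum_i x i 0 ^+ 2 = 0.
  by have := sqr_euclid_norm x; rewrite x0 expr0n dotmxE /=.
move/eqP; rewrite psumr_eq0; last by move=> i _; rewrite sqr_ge0.
move/allP => xi0; apply/colP => i; rewrite mxE.
by have /eqP := xi0 i (mem_index_enum _); move/eqP; rewrite sqrf_eq0 => /eqP.
Qed.

Lemma euclid_normZ n a (x : 'cV[R]_n) : euclid_norm (a *: x) = `|a| * euclid_norm x.
Proof.
apply/eqP; rewrite -(@eqrXn2 _ 2)// ?mulr_ge0 ?euclid_norm_ge0//.
rewrite exprMn !sqr_euclid_norm real_normK ?num_real//.
by rewrite [(a *: x)^T]linearZ/= -scalemxAl -scalemxAr scalerA mxE expr2.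
Qed.

(** With [a] and [b] the norms of [x] and [y], expanding the squared norm of [b *: x - a *: y] gives
    [2ab (ab - <x, y>)], which is nonnegative; when [x] and [y] are nonzero, [2ab] can be
    cancelled. *)
Lemma Cauchy_Schwarz n (x y : 'cV[R]_n) :
  (x^T *m y) 0 0 <= euclid_norm x * euclid_norm y.
Proof.
have [->|x0] := eqVneq x 0.
  by rewrite linear0 mul0mx mxE mulr_ge0 ?euclid_norm_ge0.
have [->|y0] := eqVneq y 0.
  by rewrite mulmx0 mxE mulr_ge0 ?euclid_norm_ge0.
have px : 0 < euclid_norm x by rewrite lt_def euclid_norm_eq0 x0 euclid_norm_ge0.
have py : 0 < euclid_norm y by rewrite lt_def euclid_norm_eq0 y0 euclid_norm_ge0.
set a := euclid_norm x in px *; set b := euclid_norm y in py *.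
have : 0 <= euclid_norm (b *: x - a *: y) ^+ 2 by rewrite sqr_ge0.
have -> : euclid_norm (b *: x - a *: y) ^+ 2 =
    b ^+ 2 * a ^+ 2 + a ^+ 2 * b ^+ 2 - 2 * (a * b) * (x^T *m y) 0 0.
  have -> : b ^+ 2 * a ^+ 2 = b ^+ 2 * \sum_i x i 0 * x i 0.
    by rewrite /a sqr_euclid_norm dotmxE.
  have -> : a ^+ 2 * b ^+ 2 = a ^+ 2 * \sum_i y i 0 * y i 0.
    by rewrite /b sqr_euclid_norm dotmxE.
  rewrite sqr_euclid_norm !dotmxE !mulr_sumr -!big_split/= -sumrB.
  by apply: eq_bigr => i _; rewrite !mxE; ring.
have -> : b ^+ 2 * a ^+ 2 + a ^+ 2 * b ^+ 2 - 2 * (a * b) * (x^T *m y) 0 0 =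
  (2 * (a * b)) * (a * b - (x^T *m y) 0 0) by ring.
by rewrite pmulr_rge0 ?subr_ge0// !mulr_gt0.
Qed.

Lemma sqr_Cauchy_Schwarz n (x y : 'cV[R]_n) :
  (x^T *m y) 0 0 ^+ 2 <= euclid_norm x ^+ 2 * euclid_norm y ^+ 2.
Proof.
rewrite -exprMn -[leLHS]real_normK ?num_real// lerXn2r ?nnegrE//.
  by rewrite mulr_ge0 ?euclid_norm_ge0.
rewrite ler_norml Cauchy_Schwarz andbT lerNl.
have := Cauchy_Schwarz (- x) y; rewrite linearN mulNmx mxE.
by rewrite -[- x]scaleN1r euclid_normZ normrN1 mul1r.
Qed.

(** The Frobenius norm is an upper bound, by Cauchy-Schwarz on each row. Boundedness is what makes
    [op_norm] a genuine supremum rather than the default value of [sup]. *)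
Lemma op_norm_has_ubound n (M : 'M[R]_n) :
  has_ubound [set euclid_norm (M *m x) | x in [set x : 'cV[R]_n | euclid_norm x = 1]].
Proof.
exists (Num.sqrt (\sum_i euclid_norm (row i M)^T ^+ 2)) => _ [x /= x1 <-].
apply: ler_wsqrtr; apply: ler_sum => i _.
have := sqr_Cauchy_Schwarz (row i M)^T x; rewrite x1 expr1n mulr1 trmxK.
by rewrite -row_mul mxE.
Qed.

Lemma op_norm_ge0 n (M : 'M[R]_n) : 0 <= op_norm M.
Proof.
have [[y Ey]|E0] := pselect ([set euclid_norm (M *m x) |
    x in [set x : 'cV[R]_n | euclid_norm x = 1]] !=set0).
  apply: (@le_trans _ _ y); first by case: Ey => x _ <-; exact: euclid_norm_ge0.
  by apply: ub_le_sup => //; exact: op_norm_has_ubound.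
(* With an empty unit sphere, [sup] takes its default value 0. *)
by rewrite /op_norm sup_out// => -[/E0].
Qed.

Lemma euclid_norm_mulmx n (M : 'M[R]_n) (x : 'cV[R]_n) :
  euclid_norm (M *m x) <= op_norm M * euclid_norm x.
Proof.
have [->|x0] := eqVneq x 0.
  by rewrite mulmx0 (_ : euclid_norm 0 = 0) ?mulr0//; apply/eqP; rewrite euclid_norm_eq0.
have px : 0 < euclid_norm x by rewrite lt_def euclid_norm_eq0 x0 euclid_norm_ge0.
rewrite -ler_pdivrMr// mulrC -[(_^-1)]gtr0_norm ?invr_gt0// -euclid_normZ scalemxAr.
apply: ub_le_sup; first exact: op_norm_has_ubound.
exists ((euclid_norm x)^-1 *: x) => //=.
by rewrite euclid_normZ gtr0_norm ?invr_gt0// mulVf ?gt_eqF.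
Qed.

Lemma sqr_euclid_norm_mulmx n (M : 'M[R]_n) (x : 'cV[R]_n) :
  euclid_norm (M *m x) ^+ 2 <= op_norm M ^+ 2 * euclid_norm x ^+ 2.
Proof.
by rewrite -exprMn lerXn2r ?nnegrE ?mulr_ge0 ?euclid_norm_ge0 ?op_norm_ge0// euclid_norm_mulmx.
Qed.

End EuclideanNorm.

(** * Cholesky factorization and Hadamard's inequality *)

Section PositiveDefinite.
Context {R : realType}.

(** Symmetry is included because over the reals positivity of the quadratic form does not imply
    it. *)
Definition posdef_mx n (P : 'M[R]_n) : Prop :=
  P^T = P /\ forall x : 'cV[R]_n, x != 0 -> 0 < (x^T *m P *m x) 0 0.

Lemma posdef_mx_diag_gt0 n (P : 'M[R]_n) i : posdef_mx P -> 0 < P i i.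
Proof.
move=> [_ /(_ (delta_mx i 0))].
rewrite trmx_delta -rowE -colE !mxE; apply.
by apply/eqP => /matrixP /(_ i 0); rewrite !mxE !eqxx/= => /eqP; rewrite oner_eq0.
Qed.

(** Induction on the size: split off the first row and column, and factor the Schur complement of
    the corner entry, which is again positive definite. *)
Lemma Cholesky n (P : 'M[R]_n) : posdef_mx P ->
  exists L : 'M[R]_n, [/\ is_trig_mx L, \det L != 0 & P = L *m L^T].
Proof.
elim: n P => [|n IH] P hP.
  exists 0; split; [exact: mx0_is_trig| by rewrite det_mx00 oner_eq0|].
  by apply/matrixP => -[].
have [Psym Ppos] := hP.
have a_gt0 := posdef_mx_diag_gt0 0 hP.
(* The size is put in the form [1 + n] so that the block operations apply. *)
rewrite -[n.+1]/(1 + n)%N in P hP Psym Ppos a_gt0 *.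
set a := P 0 0 in a_gt0.
pose b := dlsubmx P; pose C := drsubmx P.
have PE : P = block_mx a%:M b^T b C.
  rewrite -[LHS]submxK; congr block_mx.
    by rewrite [LHS]mx11_scalar; congr (_ %:M); rewrite !mxE; congr (P _ _); apply/val_inj.
  by rewrite /b -{1}Psym trmx_dlsub.
have Csym : C^T = C by rewrite /C trmx_drsub Psym.
pose C' := C - a^-1 *: (b *m b^T).
have [L' [L'trig L'det L'E]] : exists L' : 'M[R]_n,
    [/\ is_trig_mx L', \det L' != 0 & C' = L' *m L'^T].
  apply: IH; split.
    by rewrite /C' linearB/= linearZ/= trmx_mul trmxK Csym.
  move=> x x0.
  (* The first coordinate minimises the quadratic form of P for fixed x. *)
  pose t := - a^-1 *: (b^T *m x).
  have := Ppos (col_mx t x).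
  have -> : col_mx t x != 0.
    by apply: contra_neq x0 => /eqP; rewrite col_mx_eq0 => /andP[_ /eqP].
  move=> /(_ isT); rewrite PE tr_col_mx mul_row_block mul_row_col.
  have -> : t^T *m a%:M + x^T *m b = 0.
    rewrite mul_mx_scalar /t linearZ/= scalerA mulrN mulfV ?gt_eqF//.
    by rewrite trmx_mul trmxK scaleN1r addNr.
  rewrite mul0mx add0r.
  suff -> : t^T *m b^T + x^T *m C = x^T *m C' by [].
  rewrite /C' mulmxBr /t linearZ/= trmx_mul trmxK scaleNr mulNmx addrC.
  by rewrite -scalemxAl -scalemxAr mulmxA.
(* The first column is forced by the first column of [P]; its lower block contributes
   [a^-1 *: (b *m b^T)], exactly what [C'] subtracts from [C]. *)
exists (block_mx (Num.sqrt a)%:M 0 ((Num.sqrt a)^-1 *: b) L').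
have sa : Num.sqrt a != 0 by rewrite gt_eqF ?sqrtr_gt0.
have saa : Num.sqrt a * Num.sqrt a = a by rewrite -expr2 sqr_sqrtr// ltW.
split.
- by rewrite is_trig_block_mx// eqxx L'trig mx11_is_trig.
- by rewrite det_lblock det_scalar1 mulf_neq0.
rewrite tr_block_mx mulmx_block trmx0 !mulmx0 !mul0mx !addr0.
rewrite PE tr_scalar_mx -scalar_mxM saa; congr block_mx.
- by rewrite linearZ/= mul_scalar_mx scalerA mulfV// scale1r.
- by rewrite mul_mx_scalar scalerA mulfV// scale1r.
- rewrite -L'E linearZ/= -scalemxAl -scalemxAr scalerA -invfM saa /C'.
  by rewrite addrC subrK.
Qed.

Lemma mulmx_trmx_diag n (M : 'M[R]_n) i : (M *m M^T) i i = \sum_j M i j ^+ 2.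
Proof. by rewrite mxE; apply: eq_bigr => j _; rewrite mxE expr2. Qed.

(** For the Cholesky factor [L], the determinant is the product of the [L i i ^+ 2], and each is one
    term of [P i i], the sum of squares of row [i] of [L]. *)
Lemma Hadamard n (P : 'M[R]_n) : posdef_mx P -> \det P <= \prod_i P i i.
Proof.
move=> /Cholesky[L [Ltrig _ ->]].
rewrite det_mulmx det_tr det_trig// -big_split/=; apply: ler_prod => i _.
rewrite -expr2 sqr_ge0 mulmx_trmx_diag (bigD1 i)//= lerDl.
by apply: sumr_ge0 => j _; rewrite sqr_ge0.
Qed.

Lemma posdef_mx_mulmx_tr n (M : 'M[R]_n) : \det M != 0 -> posdef_mx (M *m M^T).
Proof.
move=> M0; split; first by rewrite trmx_mul trmxK.
move=> x x0; have -> : x^T *m (M *m M^T) *m x = (M^T *m x)^T *m (M^T *m x).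
  by rewrite trmx_mul trmxK !mulmxA.
rewrite -sqr_euclid_norm exprn_even_gt0//= euclid_norm_eq0.
apply: contra_neq x0 => Mx0; have Mu : M^T \in unitmx by rewrite unitmx_tr unitmxE unitfE.
by rewrite -[x](mulKmx Mu) Mx0 mulmx0.
Qed.

(** * Norms of congruences and determinants of the identity plus a skew matrix *)

Lemma sqr_euclid_norm_factor n (W : 'M[R]_n) (x : 'cV[R]_n) :
  euclid_norm (W *m x) ^+ 2 <= op_norm (W^T *m W) * euclid_norm x ^+ 2.
Proof.
rewrite sqr_euclid_norm trmx_mul -mulmxA.
apply: (le_trans (Cauchy_Schwarz _ _)).
by rewrite expr2 mulrCA ler_wpM2l ?euclid_norm_ge0// mulmxA euclid_norm_mulmx.
Qed.

(** The bound uses [W^T *m W], not [W *m W^T]. With [y = W^T *m x], the squared norm of [y] equals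
    [<x, W y>]; squaring, Cauchy-Schwarz and the bound on [W *m y] leave a factor [|y|^2] to
    cancel. *)
Lemma sqr_euclid_norm_trfactor n (W : 'M[R]_n) (x : 'cV[R]_n) :
  euclid_norm (W^T *m x) ^+ 2 <= op_norm (W^T *m W) * euclid_norm x ^+ 2.
Proof.
set y := W^T *m x.
have [->|y0] := eqVneq y 0.
  have /eqP -> : euclid_norm (0 : 'cV[R]_n) == 0 by rewrite euclid_norm_eq0.
  by rewrite expr0n/= mulr_ge0 ?sqr_ge0 ?op_norm_ge0.
have py : 0 < euclid_norm y ^+ 2 by rewrite exprn_even_gt0//= euclid_norm_eq0.
rewrite -(ler_pM2l py) -expr2.
have {1}-> : euclid_norm y ^+ 2 = (x^T *m (W *m y)) 0 0.
  by rewrite sqr_euclid_norm /y trmx_mul trmxK -mulmxA.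
apply: (le_trans (sqr_Cauchy_Schwarz _ _)).
rewrite [leRHS]mulrA [leRHS]mulrC ler_wpM2l ?sqr_ge0// [leRHS]mulrC.
exact: sqr_euclid_norm_factor.
Qed.

Lemma sqr_euclid_norm_congr n (W S : 'M[R]_n) (x : 'cV[R]_n) :
  euclid_norm (W *m S *m W^T *m x) ^+ 2
    <= (op_norm S * op_norm (W^T *m W)) ^+ 2 * euclid_norm x ^+ 2.
Proof.
set p := op_norm (W^T *m W).
have p0 : 0 <= p := op_norm_ge0 _.
rewrite -!mulmxA; apply: (le_trans (sqr_euclid_norm_factor _ _)).
have := sqr_euclid_norm_mulmx S (W^T *m x).
move=> /(ler_wpM2l p0) /le_trans; apply.
have := sqr_euclid_norm_trfactor W x.
move=> /(ler_wpM2l (sqr_ge0 (op_norm S))) /(ler_wpM2l p0) /le_trans; apply.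
by rewrite -/p le_eqVlt; apply/orP; left; apply/eqP; ring.
Qed.

(** A singular [1%:M + K] would give a nonzero row [v = v *m K], but [v *m K *m v^T] vanishes for
    skew [K], forcing [v *m v^T = 0]. *)
Lemma det_add1_skew_neq0 n (K : 'M[R]_n) : K^T = - K ->
  \det (1%:M + K) != 0.
Proof.
move=> Kskew; apply/eqP => /eqP; rewrite -det_tr => /det0P[v v0].
rewrite linearD/= trmx1 Kskew mulmxBr mulmx1 => /eqP; rewrite subr_eq0 => /eqP vK.
have : (v *m v^T) 0 0 = 0.
  have e : v *m v^T = - (v *m v^T).
    by rewrite {2}vK trmx_mul Kskew mulNmx mulmxN mulmxA -vK.
  have : (v *m v^T) 0 0 = - (v *m v^T) 0 0 by rewrite {1}e mxE.
  lra.
rewrite -{1}[v]trmxK -sqr_euclid_norm => /eqP.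
rewrite sqrf_eq0 euclid_norm_eq0 => /eqP vT0.
by move: v0; rewrite -[v]trmxK vT0 linear0 eqxx.
Qed.

Lemma sqr_det_add1_skew n (K : 'M[R]_n) c : K^T = - K ->
    (forall x : 'cV[R]_n, euclid_norm (K *m x) ^+ 2 <= c * euclid_norm x ^+ 2) ->
  \det (1%:M + K) ^+ 2 <= (c + 1) ^+ n.
Proof.
move=> Kskew Kc.
have -> : \det (1%:M + K) ^+ 2 = \det ((1%:M + K) *m (1%:M + K)^T).
  by rewrite det_mulmx det_tr expr2.
apply: (le_trans (Hadamard (posdef_mx_mulmx_tr (det_add1_skew_neq0 Kskew)))).
rewrite -[X in (c + 1) ^+ X]card_ord -prodr_const.
have -> : (1%:M + K) *m (1%:M + K)^T = 1%:M + K^T *m K.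
  rewrite linearD/= trmx1 Kskew mulmxDr mulmx1 mulmxDl mul1mx.
  by rewrite mulmxN mulNmx addrA addrK.
apply: ler_prod => i _.
(* At a basis vector the hypothesis bounds the squared norm of column [i] of [K], that is, the
   diagonal entry of [K^T *m K]. *)
have := Kc (delta_mx i 0).
rewrite !sqr_euclid_norm -colE.
have -> : ((col i K)^T *m col i K) 0 0 = (K^T *m K) i i.
  by rewrite dotmxE mxE; apply: eq_bigr => j _; rewrite !mxE.
rewrite trmx_delta mul_delta_mx [delta_mx 0 0 0 0]mxE !eqxx/= mulr1 => Kii.
rewrite mxE [1%:M i i]mxE eqxx/= [c + _]addrC lerD2l Kii andbT.
by rewrite addr_ge0// mxE sumr_ge0// => j _; rewrite mxE -expr2 sqr_ge0.
Qed.

End PositiveDefinite.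

(** * The determinant bound for a fixed scaling factor *)

Section MainInequality.
Context {R : realType} {n : nat}.
Implicit Types A B D : 'M[R]_n.

Lemma Sym_add_Skew B : Sym B + Skew B = B.
Proof. by apply/matrixP => i j; rewrite !mxE; field. Qed.

Lemma trmx_Skew B : (Skew B)^T = - Skew B.
Proof. by apply/matrixP => i j; rewrite !mxE; ring. Qed.

Lemma Sym_mulmx_diag A D i : is_diag_mx D -> Sym (D *m A) i i = D i i * A i i.
Proof.
by move=> /diag_mxP[d ->]; rewrite mul_diag_mx !mxE eqxx mulr1n; field.
Qed.

Lemma lyapunov_factors_posdef A D :
  lyapunov_factors (- A) D -> posdef_mx (Sym (D *m A)).
Proof.
move=> [[Ddiag _] neg]; split.
  by apply/matrixP => i j; rewrite !mxE addrC.
have DT : D^T = D.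
  by have [d ->] := diag_mxP _ Ddiag; rewrite tr_diag_mx.
move=> x /neg.
have -> : D *m - A + (- A)^T *m D = - (2 *: Sym (D *m A)).
  rewrite /Sym scalerA mulfV ?pnatr_eq0// scale1r trmx_mul DT.
  by rewrite mulmxN linearN mulNmx opprD.
rewrite mulmxN mulNmx -scalemxAr -scalemxAl !mxE oppr_lt0.
by rewrite pmulr_rgt0.
Qed.

(** Squaring keeps the exponent an integer, since Hadamard's inequality controls the square of
    [\det (1%:M + K)]. *)
Lemma sqr_det_le_Sym_Skew B : posdef_mx (Sym B) ->
  \det B ^+ 2 <=
    ((op_norm (Skew B) * op_norm (invmx (Sym B))) ^+ 2 + 1) ^+ n
      * (\prod_i Sym B i i) ^+ 2.
Proof.
move=> hP; have [L [_ L0 PE]] := Cholesky hP.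
have Lu : L \in unitmx by rewrite unitmxE unitfE.
have LTu : L^T \in unitmx by rewrite unitmx_tr.
pose W := invmx L; pose K := W *m Skew B *m W^T.
have WE : W^T *m W = invmx (Sym B).
  have Pu : Sym B \in unitmx by rewrite PE unitmx_mul Lu.
  rewrite -[LHS]mulmx1 -(mulmxV Pu) {1}PE mulmxA.
  by rewrite -!mulmxA (mulmxA W) mulVmx// mul1mx mulmxA -trmx_mul mulmxV// trmx1 mul1mx.
have BE : B = L *m (1%:M + K) *m L^T.
  rewrite mulmxDr mulmx1 mulmxDl -PE -[LHS]Sym_add_Skew /K; congr (_ + _).
  rewrite !mulmxA mulmxV// mul1mx -mulmxA -trmx_mul mulmxV//.
  by rewrite trmx1 mulmx1.
have Kskew : K^T = - K.
  by rewrite /K !trmx_mul trmxK trmx_Skew mulNmx mulmxN !mulmxA.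
have detK := sqr_det_add1_skew Kskew (sqr_euclid_norm_congr W (Skew B)).
have detB : \det B = \det (1%:M + K) * \det (Sym B).
  by rewrite {1}BE PE !det_mulmx; ring.
rewrite detB exprMn -WE.
(* Nonnegativity allows Hadamard's inequality for [Sym B] to be squared. *)
have detP0 : 0 <= \det (Sym B) by rewrite PE det_mulmx det_tr -expr2 sqr_ge0.
apply: ler_pM => //; rewrite ?sqr_ge0//.
by rewrite lerXn2r ?nnegrE ?Hadamard// (le_trans detP0)// Hadamard.
Qed.

Lemma lyapunov_factors_diag_gt0 A D i :
  lyapunov_factors (- A) D -> 0 < A i i.
Proof.
move=> hD; have := posdef_mx_diag_gt0 i (lyapunov_factors_posdef hD).
have [[Ddiag Dpos] _] := hD.
by rewrite Sym_mulmx_diag// pmulr_rgt0.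
Qed.

(** The diagonal of [Sym (D *m A)] has product [\det D * \prod_i A i i], so [\det D ^+ 2] cancels
    from both sides of the bound for [D *m A]. *)
Lemma sqr_det_le_lyapunov A D : lyapunov_factors (- A) D ->
  \det A ^+ 2 <=
    ((op_norm (Skew (D *m A)) * op_norm (invmx (Sym (D *m A)))) ^+ 2 + 1) ^+ n
      * (\prod_i A i i) ^+ 2.
Proof.
move=> hD; have := sqr_det_le_Sym_Skew (lyapunov_factors_posdef hD).
set c := (_ ^+ 2 + 1).
have [[Ddiag Dpos] _] := hD.
have detD : \det D = \prod_i D i i by rewrite det_trig// is_diag_mx_is_trig.
have detD0 : 0 < \det D by rewrite detD prodr_gt0.
have -> : \prod_i Sym (D *m A) i i = \det D * \prod_i A i i.
  by rewrite detD -big_split/=; apply: eq_bigr => i _; rewrite Sym_mulmx_diag.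
by rewrite det_mulmx !exprMn [leRHS]mulrCA ler_pM2l// exprn_gt0.
Qed.

End MainInequality.

(* For n > 0 each bound is equivalent to sqrt (q ^ (1/n) - 1) <= c, which passes
   to the infimum; the square root is 0 when q < 1. *)
Lemma le_inf_sqrD1X (R : realType) n (E : set R) (q : R) :
    E !=set0 -> (forall c, E c -> 0 <= c) -> 0 <= q ->
    (forall c, E c -> q <= (c ^+ 2 + 1) ^+ n) ->
  q <= (inf E ^+ 2 + 1) ^+ n.
Proof.
(* At [n = 0] there is no root to take, but both powers are 1 and any member of [E] gives the
   claim. *)
case: n => [|n] [c Ec] E0 q0 qE; first by move: (qE c Ec); rewrite !expr0.
pose r := q `^ (n.+1%:R^-1).
have r0 : 0 <= r := powR_ge0 _ _.
have rn : r ^+ n.+1 = q.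
  by rewrite -powR_mulrn// /r -powRrM mulVf ?pnatr_eq0// powRr1.
have r_le d : 0 <= d -> (q <= (d ^+ 2 + 1) ^+ n.+1) = (r <= d ^+ 2 + 1).
  by move=> d0; rewrite -rn ler_pXn2r// nnegrE addr_ge0// sqr_ge0.
have infE0 : 0 <= inf E by apply: lb_le_inf; [exists c | move=> d /E0].
rewrite r_le// -lerBlDr.
have : Num.sqrt (r - 1) <= inf E.
  apply: lb_le_inf; first by exists c.
  move=> d Ed; rewrite -[d]ger0_norm ?E0// -sqrtr_sqr ler_wsqrtr//.
  by rewrite lerBlDr -r_le ?E0// qE.
have [r1|/ltW r1] := leP 0 (r - 1); last by rewrite (le_trans r1)// sqr_ge0.
by rewrite -[X in _ -> X <= _](sqr_sqrtr r1) => ?; rewrite lerXn2r// nnegrE sqrtr_ge0.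
Qed.

Theorem theorem13 (R : realType) (n : nat) (A : 'M[R]_n)
    (hA : diag_stable (- A)) :
  \det A <=
    ((inf [set op_norm (Skew (D *m A)) * op_norm (invmx (Sym (D *m A)))
          | D in lyapunov_factors (- A)]) ^+ 2 + 1) `^ (n%:R / 2)
    * \prod_(i < n) A i i.
Proof.
have [D0 hD0] := hA.
have prodA : 0 < \prod_i A i i.
  by apply: prodr_gt0 => i _; exact: lyapunov_factors_diag_gt0 hD0.
set E := [set _ | D in _].
have E0 c : E c -> 0 <= c by move=> [D _ <-]; rewrite mulr_ge0 ?op_norm_ge0.
have q_le : (\det A / \prod_i A i i) ^+ 2 <= (inf E ^+ 2 + 1) ^+ n.
  apply: le_inf_sqrD1X => //; [|exact: sqr_ge0|].
    by exists (op_norm (Skew (D0 *m A)) * op_norm (invmx (Sym (D0 *m A)))), D0.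
  move=> _ [D hD <-]; rewrite exprMn exprVn ler_pdivrMr ?exprn_gt0//.
  exact: sqr_det_le_lyapunov.
have i1 : 0 <= inf E ^+ 2 + 1 by rewrite addr_ge0// sqr_ge0.
(* Passing to the absolute value handles a possibly negative quotient; both sides are then
   nonnegative, and squaring turns the exponent [n / 2] into [n]. *)
rewrite -ler_pdivrMr//; apply: (le_trans (ler_norm _)).
rewrite -(@ler_pXn2r _ 2) ?nnegrE ?powR_ge0// real_normK ?num_real//.
by rewrite -[leRHS]powR_mulrn ?powR_ge0// -powRrM divfK ?pnatr_eq0// powR_mulrn.
Qed.
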